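(* If $\mu$ is a probability measure on $[0,1]$ with positive Fourier dimension with decay $|\hat\mu(\xi)| = O(|\xi|^{-\tau})$, $\mathbf a=(a_n)$ is an integer sequence with $|a_m - a_n|>c|m-n|^{\frac{1}{\tau} + \varepsilon}$ for some $c, \varepsilon>0$ and $\psi(n) = n^{-\sigma}$ for some $\sigma < 1$, then $\lambda(W(\psi,\mathbf a,\alpha)) = 1$ for $\mu$-almost every $\alpha$.
   Context: For an increasing integer sequence $\mathbf a=(a_n)$, a function $\psi:\mathbb{N}\to\mathbb{R}$ and $\alpha\in[0,1]$, define $W(\psi,\mathbf a,\alpha) = \{\gamma\in[0,1] : \|a_n\alpha - \gamma\| < \psi(n) \text{ for infinitely many } n\}$, where $\|\cdot\|$ denotes distance to the nearest integer. The Fourier transform of $\mu$ is $\hat\mu(\xi) = \int e^{2\pi i x\xi}\,d\mu(x)$, and the Fourier dimension of $\mu$ is $\sup\{s\in[0,1] : |\hat\mu(\xi)| = O(|\xi|^{-s/2})\}$. $\lambda$ denotes one-dimensional Lebesgue measure. *)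

(* Defs.v *)
From HB Require Import structures.
From mathcomp Require Export all_boot all_order all_algebra.
From mathcomp Require Export all_classical all_reals all_analysis.
From mathcomp Require Export complex.

Set Implicit Arguments.
Unset Strict Implicit.
Unset Printing Implicit Defensive.

Import Order.TTheory GRing.Theory Num.Theory.
Import numFieldNormedType.Exports.

Local Open Scope classical_set_scope.
Local Open Scope ring_scope.

Definition dist_nearest_int (R : realType) (x : R) : R :=
  inf [set `|x - z%:~R| | z in [set: int]].

(* Sequences are indexed by the positive integers; the values of [psi] and [a]
   at 0 are never used. *)
Definition W (R : realType) (psi : nat -> R) (a : nat -> int) (alpha : R)
    : set R :=
  [set gamma | gamma \in `[0, 1] /\
    infinite_set [set n | (0 < n)%N /\
      dist_nearest_int ((a n)%:~R * alpha - gamma) < psi n]].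

(* e^{it}, written out by Euler's formula. *)
Definition expi (R : realType) (t : R) : R[i] := (cos t +i* sin t)%C.

(* The complex-valued integral is taken componentwise. *)
Definition fourier_transform (R : realType) (mu : probability R R) (xi : R)
    : R[i] :=
  (Rintegral mu setT (fun x => complex.Re (expi (2 * pi * x * xi))) +i*
   Rintegral mu setT (fun x => complex.Im (expi (2 * pi * x * xi))))%C.

(* |fourier_transform mu xi| = O(|xi|^{-t}) as |xi| -> oo; the inequality is
   between real elements of R[i], where the complex modulus takes its values. *)
Definition fourier_decay (R : realType) (mu : probability R R) (t : R) : Prop :=
  exists C M : R, forall xi : R, M < `|xi| ->
    `|fourier_transform mu xi| <= ((C * `|xi| `^ (- t))%:C)%C.

Definition fourier_dimension (R : realType) (mu : probability R R) : R :=
  sup [set s : R | 0 <= s <= 1 /\ fourier_decay mu (s / 2)].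

(* Main.v *)
Require Import Defs.
From mathcomp Require Import measurable_realfun ring lra zify.

Import Order.TTheory GRing.Theory Num.Theory.
Import numFieldNormedType.Exports.

Local Open Scope classical_set_scope.
Local Open Scope ring_scope.

Set Implicit Arguments.
Unset Strict Implicit.

                                                                    
                                                                              
                                                                                  
                                                                      
                                                                               
                                                                                
                                                                           
                                                                         
                                                                                
                                                                              
                                                                            
                                             

(** Write e(x) for exp(2 pi i x). Fix k >= 1 with sigma (k + 2) <= k, put q = k + 2, and consider
    the blocks B < n <= 2B with B = 2^(q i). On such a block n^(-sigma) is at least r = 2^(-(k i +
    1)) ([inv_radius_le]), so a gamma missed by the block is at distance at least r from every a_n
    alpha modulo 1.

    Such gamma are detected by the kernel |D_K|^(2q), where D_K(x) is the sum of e(u x) over u < K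
    and K = 2^((k + 1) i). At distance at least r from the integers the kernel is at most r^(-2q)
    ([sum_cos_diff_freqs_far]), while its mean [mass0] is at least twice that ([mass0_ge]), by
    Cauchy-Schwarz on its coefficients. So if gamma is missed, the kernel minus its mean, summed
    over the points a_n alpha - gamma, is at most -B [mass0] / 2 ([far_block_large]). Chebyshev's
    inequality and orthogonality in gamma bound the measure of the missed gamma by [corr] / (B
    [mass0] / 2)^2 ([measure_large_expsum]).

    This bound is then averaged over alpha. Only frequencies h <> 0 remain, and for them decay and
    separation bound the integral of cos(2 pi h (a_n - a_m) x) by C / |n - m|
    ([integral_cos_separated]). Summing over n and m costs a harmonic factor O(i), and the average
    is O(i K / B) = O(i 2^(-i)) ([integral_block_ratio_small]). By Markov's inequality the bound is
    arbitrarily small for infinitely many i, for almost every alpha ([ae_frequently_small]). For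
    such alpha the gamma missed from some index on form a null set. *)

(** * Squared moduli of exponential sums and the Dirichlet kernel *)

(** The squared modulus of the sum of exp(i x), kept in real form. *)
Definition expsum_sq (R : realType) (I : Type) (r : seq I) (x : I -> R) : R :=
  (\sum_(i <- r) cos (x i)) ^+ 2 + (\sum_(i <- r) sin (x i)) ^+ 2.

Lemma expsum_sqE (R : realType) (I : Type) (r : seq I) (x : I -> R) :
  expsum_sq r x = \sum_(i <- r) \sum_(j <- r) cos (x i - x j).
Proof.
rewrite /expsum_sq !expr2 !big_distrlr -big_split; apply: eq_bigr => i _ /=.
by rewrite -big_split; apply: eq_bigr => j _; rewrite cosB.
Qed.

Lemma expsum_sq_ge0 (R : realType) (I : Type) (r : seq I) (x : I -> R) :
  0 <= expsum_sq r x.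
Proof. by rewrite addr_ge0 ?sqr_ge0. Qed.

Lemma expsum_sq_allpairs (R : realType) (I J L : Type) (op : I -> J -> L)
    (r : seq I) (s : seq J) (x : I -> R) (y : J -> R) (z : L -> R) :
  (forall i j, z (op i j) = x i + y j) ->
  expsum_sq [seq op i j | i <- r, j <- s] z = expsum_sq r x * expsum_sq s y.
Proof.
move=> zE; rewrite /expsum_sq !big_allpairs_dep.
have -> : \sum_(i <- r) \sum_(j <- s) cos (z (op i j)) =
    (\sum_(i <- r) cos (x i)) * (\sum_(j <- s) cos (y j)) -
    (\sum_(i <- r) sin (x i)) * (\sum_(j <- s) sin (y j)).
  rewrite !big_distrlr -sumrB; apply: eq_bigr => i _ /=.
  by rewrite -sumrB; apply: eq_bigr => j _; rewrite zE cosD.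
have -> : \sum_(i <- r) \sum_(j <- s) sin (z (op i j)) =
    (\sum_(i <- r) sin (x i)) * (\sum_(j <- s) cos (y j)) +
    (\sum_(i <- r) cos (x i)) * (\sum_(j <- s) sin (y j)).
  rewrite !big_distrlr -big_split; apply: eq_bigr => i _ /=.
  by rewrite -big_split; apply: eq_bigr => j _; rewrite zE sinD.
by ring.
Qed.

                                                               
(** The geometric sum telescopes: multiplied by e^(it) - 1 it becomes e^(iKt) - 1, whose squared
    modulus is at most 4. The fact [tel] states this by real and imaginary parts. *)
Lemma dirichlet_sq_le (R : realType) (K : nat) (t : R) :
  expsum_sq (iota 0 K) (fun u => u%:R * t) * (2 - 2 * cos t) <= 4.
Proof.
set x := fun u : nat => _.
have tel : (\sum_(u <- iota 0 K) cos (x u)) * (cos t - 1) -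
             (\sum_(u <- iota 0 K) sin (x u)) * sin t = cos (x K) - 1 /\
           (\sum_(u <- iota 0 K) cos (x u)) * sin t +
             (\sum_(u <- iota 0 K) sin (x u)) * (cos t - 1) = sin (x K).
  elim: K => [|K [IHc IHs]].
    by rewrite /x /= !big_nil !mul0r sin0 cos0; split; ring.
  have xS : x K.+1 = x K + t by rewrite /x -natr1; ring.
  rewrite -(addn1 K) iotaD /= add0n !big_cat !big_seq1 /= addn1 xS sinD cosD.
  move: (\sum_(_ <- _) _) (\sum_(_ <- _) _) IHc IHs => S C IHc IHs.
  have c2 := cos2Dsin2 t.
  by split; [have := IHc | have := IHs]; lra.
have c2 := cos2Dsin2 t; have k2 := cos2Dsin2 (x K); have k1 := cos_geN1 (x K).
case: tel => tc ts; rewrite /expsum_sq.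
move: (\sum_(_ <- _) _) (\sum_(_ <- _) _) tc ts => S C tc ts.
suff -> : (C ^+ 2 + S ^+ 2) * (2 - 2 * cos t) = 2 - 2 * cos (x K) by lra.
have -> : 2 - 2 * cos t = (cos t - 1) ^+ 2 + sin t ^+ 2 by lra.
have -> : 2 - 2 * cos (x K) = (cos (x K) - 1) ^+ 2 + sin (x K) ^+ 2 by lra.
by rewrite -tc -ts; ring.
Qed.

(** * Cosine at a given distance from the integers *)

Lemma cos_2pi_int (R : realType) (x : R) (z : int) :
  cos (2 * pi * (x + z%:~R)) = cos (2 * pi * x).
Proof.
have nat_case (y : R) (n : nat) : cos (2 * pi * (y + n%:R)) = cos (2 * pi * y).
  rewrite -(periodicn (@cosD2pi R) n (2 * pi * y)); congr cos.
  by rewrite -mulr_natr -[in RHS]mulr_natr; ring.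
case: z => n; first exact: nat_case.
rewrite -[in RHS](subrK n.+1%:R x) nat_case; by rewrite NegzE mulrNz.
Qed.

Lemma sin_2pi_int (R : realType) (x : R) (z : int) :
  sin (2 * pi * (x + z%:~R)) = sin (2 * pi * x).
Proof.
rewrite -!cosBpihalf.
have h (y : R) : 2 * pi * y - pi / 2 = 2 * pi * (y - 4^-1) by field.
by rewrite !h addrAC cos_2pi_int.
Qed.

(** After subtracting the nearest integer [z], the argument lies between 2 pi d and pi in absolute
    value, where cosine decreases. *)
Lemma cos_le_far_int (R : realType) (x d : R) :
  0 <= d -> (forall z : int, d <= `|x - z%:~R|) ->
  cos (2 * pi * x) <= cos (2 * pi * d).
Proof.
move=> d0 far; set z := Num.floor (x + 2^-1).
have p0 := pi_gt0 R.
have zx : `|x - z%:~R| <= 2^-1.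
  have := floor_le_tmp (x + 2^-1); have := lt_succ_floor (x + 2^-1).
  by rewrite -/z intrD ler_norml; lra.
rewrite -(cos_2pi_int x (- z)) mulrNz -cos_norm normrM.
rewrite (ger0_norm (_ : 0 <= 2 * pi)); last by lra.
have dz := far z; move: (`|_|) dz zx => y dy y2.
have yin : 2 * pi * y \in `[0, (pi:R)] by rewrite in_itv /=; apply/andP; split; nra.
have din : 2 * pi * d \in `[0, (pi:R)] by rewrite in_itv /=; apply/andP; split; nra.
case: (eqVneq d y) => [->//|ndy]; apply: ltW; rewrite ltr_cos //.
by rewrite ltr_pM2l ?lt_neqAle ?ndy //; lra.
Qed.

(** By the mean value theorem sin t = t cos u with u < pi / 4, and cos(pi / 4), whose square is 1/2,
    exceeds 1/2. *)
Lemma sin_ge_half (R : realType) (t : R) : 0 <= t <= pi / 4 -> t / 2 <= sin t.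
Proof.
have p0 := pi_gt0 R.
case/andP=> t0 t4; case: (eqVneq t 0) => [->|tn0]; first by rewrite mul0r sin0.
have {}t0 : 0 < t by rewrite lt_neqAle eq_sym tn0.
have [u /=] := @MVT R (@sin R) (@cos R) 0 t t0 (fun x _ => is_derive_sin x)
  (continuous_subspaceT (@continuous_sin R)).
rewrite in_itv /= => /andP[u0 ut]; rewrite sin0 !subr0 => ->.
rewrite mulrC ler_pM2r //.
have cq : cos (pi / 4) ^+ 2 = 2^-1 :> R.
  have := cos_mulr2n (pi / 4 : R); rewrite (_ : pi / 4 *+ 2 = pi / 2); last by rewrite -mulr_natr; field.
  by rewrite cos_pihalf -mulr_natr; lra.
have cq0 : 0 <= cos (pi / 4) :> R by apply: cos_ge0_pihalf; lra.
have : cos (pi / 4) < cos u by rewrite ltr_cos ?in_itv /=; lra.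
by nra.
Qed.

Lemma one_minus_cos_ge (R : realType) (d : R) :
  0 <= d <= 4^-1 -> 2 * d ^+ 2 <= 1 - cos (2 * pi * d).
Proof.
case/andP=> d0 d4; have p2 := pi_ge2 R.
have -> : 2 * pi * d = (pi * d) *+ 2 by rewrite -mulr_natr; ring.
rewrite cos_mulr2n cos2sin2 -mulr_natr.
have pd : 2 * d <= pi * d by rewrite ler_wpM2r.
have pd4 : pi * d <= pi / 4 by rewrite ler_wpM2l // (le_trans _ p2).
have := @sin_ge_half R (pi * d); rewrite pd4 andbT => /(_ ltac:(lra)).
move: (sin _) => s sd.
have ds : d <= s by lra.
have := ler_pM d0 d0 ds ds; rewrite -!expr2; lra.
Qed.

(** * Frequencies of the kernel and their multiplicities *)

(** The frequencies of the p-th power of the Dirichlet kernel, listed with repetition so that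
    multiplicities play the part of coefficients. *)
Fixpoint freqs (K p : nat) : seq nat :=
  if p is p'.+1 then [seq (u + v)%N | u <- iota 0 K, v <- freqs K p']
  else [:: 0%N].

Lemma size_freqs (K p : nat) : size (freqs K p) = (K ^ p)%N.
Proof. by elim: p => [//|p IH]; rewrite /= size_allpairs IH size_iota expnS. Qed.

Lemma freqs_le (K p f : nat) : f \in freqs K p -> (f <= p * K)%N.
Proof.
elim: p f => [|p IH] f; first by rewrite inE => /eqP ->.
case/allpairsP => -[u v] /= []; rewrite mem_iota => uK /IH vK ->.
by rewrite mulSn leq_add // ltnW.
Qed.

(** Once p of the p + 1 summands are chosen, the total [s] determines the remaining one. *)
Lemma count_freqs (K p s : nat) : (count_mem s (freqs K p.+1) <= K ^ p)%N.
Proof.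
rewrite -sum1_count big_mkcond big_allpairs_dep exchange_big /= -size_freqs -sum1_size.
apply: leq_sum => v _; rewrite -big_mkcond /= sum1_count.
apply: leq_trans (_ : (count_mem (s - v)%N (iota 0 K) <= _)%N); last first.
  by rewrite count_uniq_mem ?iota_uniq // leq_b1.
by apply: sub_count => u /= /eqP <-; rewrite addnK.
Qed.

Lemma expsum_sq_freqs (R : realType) (K p : nat) (t : R) :
  expsum_sq (freqs K p) (fun u => u%:R * t) =
  expsum_sq (iota 0 K) (fun u => u%:R * t) ^+ p.
Proof.
elim: p => [|p IH].
  by rewrite /expsum_sq /= !big_seq1 mul0r cos0 sin0 expr0n addr0 expr1n.
rewrite exprS -IH; apply: expsum_sq_allpairs => u v; by rewrite natrD mulrDl.
Qed.

(** The frequencies of |D_K|^(2p), again with repetition. *)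
Definition diff_freqs (K p : nat) : seq int :=
  [seq (f%:Z - g%:Z) | f <- freqs K p, g <- freqs K p].

Lemma size_diff_freqs (K p : nat) : size (diff_freqs K p) = (K ^ p * K ^ p)%N.
Proof. by rewrite size_allpairs size_freqs. Qed.

(** Cauchy-Schwarz for the multiplicities of the at most [B] values of [s], obtained by summing 2xy
    <= x^2 + y^2 over all pairs. *)
Lemma sum_count_sq (B : nat) (s : seq nat) : all (fun x => (x < B)%N) s ->
  (size s ^ 2 <= B * \sum_(f <- s) count_mem f s)%N.
Proof.
move=> sB.
have sumE (G : nat -> nat) :
    (\sum_(f <- s) G f = \sum_(x < B) count_mem (x : nat) s * G x)%N.
  under [RHS]eq_bigr => x _ do rewrite -sum1_count big_distrl big_mkcond /=.
  rewrite exchange_big /= big_seq [RHS]big_seq; apply: eq_bigr => f fs.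
  have fB : (f < B)%N by move/allP: sB; apply.
  rewrite (bigD1 (Ordinal fB)) //= eqxx mul1n big1 ?addn0 // => x xf.
  by case: ifP => // /eqP fx; case/eqP: xf; apply: val_inj.
have -> : size s = (\sum_(x < B) count_mem (x : nat) s)%N.
  by rewrite -sum1_size sumE; apply: eq_bigr => x _; rewrite muln1.
rewrite sumE; set r := fun x : 'I_B => count_mem (x : nat) s.
rewrite -[X in (X ^ 2)%N]/(\sum_x r x)%N -[X in (_ <= _ * X)%N]/(\sum_x r x * r x)%N.
rewrite -(leq_pmul2l (isT : 0 < 2)%N) -mulnn big_distrlr /=.
have -> : (2 * (B * \sum_x r x * r x) =
           \sum_(x < B) \sum_(y < B) (r x ^ 2 + r y ^ 2))%N.
  under [RHS]eq_bigr => x _ do rewrite big_split /= sum_nat_const card_ord.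
  rewrite big_split /= -big_distrr sum_nat_const card_ord /= mul2n -addnn.
  by congr (_ * _ + _ * _)%N; apply: eq_bigr => x _; rewrite mulnn.
rewrite big_distrr; apply: leq_sum => x _; rewrite big_distrr.
by apply: leq_sum => y _; apply: nat_Cauchy.
Qed.

(** The multiplicity of frequency 0 is the sum of the squared multiplicities in [freqs K p], whose
    K^p entries take at most pK + 1 values. *)
Lemma count_diff_freqs0 (K p : nat) :
  (K ^ p * K ^ p <= (p * K).+1 * count_mem 0%R (diff_freqs K p))%N.
Proof.
have -> : count_mem 0%R (diff_freqs K p) =
    (\sum_(f <- freqs K p) count_mem f (freqs K p))%N.
  rewrite -sum1_count big_mkcond big_allpairs_dep; apply: eq_bigr => f _.
  rewrite -sum1_count [RHS]big_mkcond; apply: eq_bigr => g _ /=.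
  by rewrite subr_eq0 eqz_nat eq_sym.
rewrite mulnn -(size_freqs K p); apply: sum_count_sq.
by apply/allP => f /freqs_le; rewrite ltnS.
Qed.

Lemma count_diff_freqs (K p : nat) (h : int) :
  (count_mem h (diff_freqs K p.+1) <= K ^ p.+1 * K ^ p)%N.
Proof.
rewrite -sum1_count big_mkcond big_allpairs_dep exchange_big /=.
rewrite -(size_freqs K p.+1) -sum1_size big_distrl.
apply: leq_sum => g _; rewrite /= mul1n -big_mkcond sum1_count.
(* For given [g], only f = h + g counts. If h + g is negative no [f] counts, so the absolute value
   is harmless. *)
apply: leq_trans _ (count_freqs K p `|(h + g%:Z)%R|%N); apply: sub_count => f /= /eqP <-.
by rewrite subrK.
Qed.

Lemma sum_cos_diff_freqs (R : realType) (K p : nat) (x : R) :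
  \sum_(h <- diff_freqs K p) cos (2 * pi * (h%:~R * x)) =
  expsum_sq (iota 0 K) (fun u => u%:R * (2 * pi * x)) ^+ p.
Proof.
rewrite -expsum_sq_freqs expsum_sqE big_allpairs_dep; apply: eq_bigr => f _.
by apply: eq_bigr => g _; congr cos; rewrite rmorphB /=; ring.
Qed.

Lemma sum_cos_diff_freqs_far (R : realType) (K p : nat) (x d : R) :
  0 < d <= 4^-1 -> (forall z : int, d <= `|x - z%:~R|) ->
  \sum_(h <- diff_freqs K p) cos (2 * pi * (h%:~R * x)) <= d ^- 2 ^+ p.
Proof.
case/andP=> d0 d4 far; rewrite sum_cos_diff_freqs.
apply: lerXn2r; rewrite ?nnegrE ?expsum_sq_ge0 ?invr_ge0 ?sqr_ge0 //.
have := dirichlet_sq_le K (2 * pi * x).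
have := cos_le_far_int (ltW d0) far.
have := @one_minus_cos_ge R d; rewrite (ltW d0) d4 => /(_ isT).
have := expsum_sq_ge0 (iota 0 K) (fun u => u%:R * (2 * pi * x)).
move: (expsum_sq _ _) (cos _) (cos _) => D cd cx D0 h1 h2 h3.
rewrite -[X in _ <= X]div1r ler_pdivlMr ?exprn_gt0 //; nra.
Qed.

(** * Second moment in gamma *)

Lemma continuous_cos_affine (R : realType) (u v : R) :
  continuous (fun x : R => cos (u + v * x)).
Proof.
move=> x; apply: continuous_comp; last exact: continuous_cos.
by apply: cvgD; [exact: cvg_cst | apply: cvgM; [exact: cvg_cst | exact: cvg_id]].
Qed.

Lemma measurable_cos_affine (R : realType) (D : set R) (u v : R) :
  measurable D -> measurable_fun D (fun x : R => cos (u + v * x)).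
Proof.
move=> mD; apply: measurable_funTS; apply: continuous_measurable_fun.
exact: continuous_cos_affine.
Qed.

Lemma integrable_cos_affine d (T : measurableType d) (R : realType)
    (m : {measure set T -> \bar R}) (D : set T) (X : T -> R) (u v : R) :
  measurable D -> (m D < +oo)%E -> measurable_fun D X ->
  m.-integrable D (fun x => (cos (u + v * X x))%:E).
Proof.
move=> mD fD mX.
apply: (@measurable_bounded_integrable _ _ _ _ (fun x => cos (u + v * X x))) => //.
  exact: measurableT_comp (measurable_cos_affine u v measurableT) mX.
exists 1; split => // M M1 x _ /=.
exact: le_trans (cos_max _) (ltW M1).
Qed.

Lemma integral_cos_unit (R : realType) (u : R) (k : int) :
  (\int[lebesgue_measure]_(g in `[0%R, 1%R]) (cos (u + 2 * pi * k%:~R * g))%:E =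
   (if k == 0 then cos u else 0)%:E)%E.
Proof.
case: eqVneq => [->|k0].
  under eq_integral do rewrite mulr0z mulr0 mul0r addr0.
  rewrite integral_cst //= lebesgue_measure_itv /= lte_fin ltr01.
  by rewrite oppr0 adde0 mule1.
have p0 := pi_gt0 R.
have v0 : 2 * pi * k%:~R != 0 :> R.
  by rewrite !mulf_eq0 intr_eq0 (negPf k0) pnatr_eq0 (gt_eqF p0).
set v := 2 * pi * k%:~R in v0 *.
pose F (g : R) := v^-1 * sin (u + v * g).
have dF (g : R) : is_derive g 1 F (cos (u + v * g)).
  rewrite /F; apply: is_derive_eq.
  rewrite /GRing.scale /= !(mulr0, mul0r, add0r, addr0, mulr1, mul1r).
  by rewrite mulrCA mulVf // mulr1.
rewrite (@continuous_FTC2 R (fun g => cos (u + v * g)) F) //.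
- rewrite -EFinB; congr (_%:E); rewrite /F mulr0 mulr1 addr0.
  have tp0 : 2 * pi != 0 :> R by rewrite mulf_eq0 pnatr_eq0 (gt_eqF p0).
  have uE : 2 * pi * (u / (2 * pi)) = u by rewrite mulrC divfK.
  by rewrite /v -{1}uE -mulrDr sin_2pi_int uE subrr.
- by apply: continuous_subspaceT; exact: continuous_cos_affine.
- have cF g : {for g, continuous F}.
    by apply: differentiable_continuous; apply/derivable1_diffP; case: (dF g).
  split=> [g _||]; first by case: (dF g).
    exact: cvg_at_right_filter (cF 0).
  exact: cvg_at_left_filter (cF 1).
- by move=> g _; rewrite derive1E; case: (dF g).
Qed.

Lemma integral_ge_measure d (T : measurableType d) (R : realType)
    (m : {measure set T -> \bar R}) (D E : set T) (f : T -> R) (A : R) :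
  measurable D -> measurable E -> E `<=` D -> measurable_fun D f -> 0 <= A ->
  (forall x, D x -> 0 <= f x) -> (forall x, E x -> A <= f x) ->
  (A%:E * m E <= \int[m]_(x in D) (f x)%:E)%E.
Proof.
move=> mD mE ED mf A0 f0 fA; rewrite -(integral_cst m mE A%:E).
apply: (@le_trans _ _ (\int[m]_(x in E) (f x)%:E)%E).
  apply: ge0_le_integral => //.
  by apply/measurable_EFinP; exact: measurable_funS mf.
apply: ge0_subset_integral => //; first exact/measurable_EFinP.
Qed.

(** The integral over gamma in [0,1] of the squared modulus of the sum of e(h (b alpha - gamma)):
    orthogonality keeps only the pairs with equal h. *)
Definition corr (R : realType) (bs hs : seq int) (alpha : R) : R :=
  \sum_(i <- [seq (b, h) | b <- bs, h <- hs])
    \sum_(j <- [seq (b, h) | b <- bs, h <- hs])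
      if i.2 == j.2 then cos (2 * pi * (i.2 * (i.1 - j.1))%:~R * alpha) else 0.

                                                                  
(** Chebyshev's inequality. The squared cosine sum is at most the squared modulus of the full
    exponential sum; expanding the latter into cosines of phase [t] + 2 pi [k] g and integrating
    over g leaves the terms with [k] = 0, which make up [corr]. *)
Lemma measure_large_expsum (R : realType) (bs hs : seq int) (alpha A : R)
    (E : set R) : measurable E -> E `<=` `[0, 1] -> 0 <= A ->
  (forall g, E g -> A <= (\sum_(b <- bs) \sum_(h <- hs)
     cos (2 * pi * (h%:~R * (b%:~R * alpha - g)))) ^+ 2) ->
  (A%:E * lebesgue_measure E <= (corr bs hs alpha)%:E)%E.
Proof.
move=> mE E01 A0 EA; set r := [seq (b, h) | b <- bs, h <- hs].
pose x (g : R) (i : int * int) := 2 * pi * (i.2%:~R * (i.1%:~R * alpha - g)).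
pose t (ij : (int * int) * (int * int)) :=
  2 * pi * (ij.1.2 * ij.1.1 - ij.2.2 * ij.2.1)%:~R * alpha.
pose k (ij : (int * int) * (int * int)) := ij.2.2 - ij.1.2.
pose r2 := [seq (i, j) | i <- r, j <- r].
have sqE g : expsum_sq r (x g) =
    \sum_(ij <- r2) cos (t ij + 2 * pi * (k ij)%:~R * g).
  rewrite expsum_sqE [RHS]big_allpairs; apply: eq_bigr => i _; apply: eq_bigr => j _.
  by congr cos; rewrite /x /t /k /= !(rmorphB, rmorphM) /=; ring.
have u01 : (lebesgue_measure `[0%R, 1%R]%classic < +oo :> \bar R)%E.
  by rewrite lebesgue_measure_itv /= lte_fin ltr01 ltry.
have -> : ((corr bs hs alpha)%:E =
    \int[lebesgue_measure]_(g in `[0%R, 1%R]) (expsum_sq r (x g))%:E)%E.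
  under [RHS]eq_integral => g _ do rewrite sqE -sumEFin.
  rewrite integral_sum //; last first.
    move=> ij; have := @integrable_cos_affine _ (measurableTypeR R) R
      lebesgue_measure `[0%R, 1%R]%classic id (t ij) (2 * pi * (k ij)%:~R).
    by apply.
  under eq_bigr => ij _ do rewrite integral_cos_unit.
  rewrite sumEFin; congr (_%:E); rewrite /corr [RHS]big_allpairs.
  apply: eq_bigr => i _; apply: eq_bigr => j _.
  rewrite /k /= subr_eq0 eq_sym; case: eqP => // ij; congr cos.
  by rewrite /t /= -ij mulrBr.
apply: integral_ge_measure => //.
- apply: (eq_measurable_fun
    (fun g => \sum_(ij <- r2) cos (t ij + 2 * pi * (k ij)%:~R * g))).
    by move=> g _; rewrite sqE.
  by apply: measurable_sum => ij; apply: measurable_cos_affine.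
- by move=> g _; exact: expsum_sq_ge0.
move=> g Eg; apply: le_trans (EA g Eg) _.
by rewrite /expsum_sq [X in X ^+ 2 + _]big_allpairs lerDl sqr_ge0.
Qed.

Lemma corr_ge0 (R : realType) (bs hs : seq int) (alpha : R) :
  0 <= corr bs hs alpha.
Proof.
have := @measure_large_expsum R bs hs alpha 0 set0 measurable0.
by rewrite measure0 mule0 lee_fin; apply.
Qed.

Lemma measurable_corr (R : realType) (bs hs : seq int) :
  measurable_fun setT (@corr R bs hs).
Proof.
apply: measurable_sum => i; apply: measurable_sum => j.
case: (_ == _); last exact: measurable_cst.
under eq_fun do rewrite -[X in cos X]add0r.
exact: measurable_cos_affine.
Qed.

(** * Averaging over alpha *)

(** The bound [kap] depends on the pair (n, m) only, so the sum over equal frequencies factors out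
    as the sum of squared multiplicities of [hs]. *)
Lemma integral_corr_le (R : realType) (mu : probability R R) (I : eqType)
    (ns : seq I) (a : I -> int) (hs : seq int) (kap : I -> I -> R) :
  (forall n m h, n \in ns -> m \in ns -> h \in hs ->
    (\int[mu]_x (cos (2 * pi * (h * (a n - a m))%:~R * x))%:E <=
     (kap n m)%:E)%E) ->
  (\int[mu]_x (corr [seq a n | n <- ns] hs x)%:E <=
   ((\sum_(n <- ns) \sum_(m <- ns) kap n m) *
    (\sum_(h <- hs) count_mem h hs)%:R)%:E)%E.
Proof.
move=> kapP; rewrite /corr.
pose f (i j : int * int) (x : R) : R :=
  if i.2 == j.2 then cos (2 * pi * (i.2 * (i.1 - j.1))%:~R * x) else 0.
have fi i j : mu.-integrable setT (fun x => (f i j x)%:E).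
  rewrite /f; case: eqP => _; last exact: integrable0.
  under eq_fun do rewrite -[X in cos X]add0r.
  apply: (@integrable_cos_affine _ _ R mu setT id) => //.
  by rewrite (le_lt_trans (probability_le1 _ _)) ?ltry.
set r := [seq (b, h) | b <- [seq a n | n <- ns], h <- hs].
rewrite (_ : (\int[mu]_x _ =
    \int[mu]_x \sum_(i <- r) \sum_(j <- r) (f i j x)%:E)%E); last first.
  apply: eq_integral => x _; rewrite -sumEFin; apply: eq_bigr => i _.
  by rewrite -sumEFin.
rewrite integral_sum //; last by move=> i; apply: integrable_sum.
rewrite (eq_bigr (fun i => \sum_(j <- r) \int[mu]_x (f i j x)%:E)%E); last first.
  by move=> i _; rewrite integral_sum.
rewrite big_allpairs big_map.
rewrite (eq_bigr (fun n => \sum_(h <- hs) \sum_(m <- ns) \sum_(h' <- hs)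
    \int[mu]_x (f (a n, h) (a m, h') x)%:E)%E); last first.
  by move=> n _; apply: eq_bigr => h _; rewrite big_allpairs big_map.
have -> : (\sum_(n <- ns) \sum_(m <- ns) kap n m) *
    (\sum_(h <- hs) count_mem h hs)%:R =
    \sum_(n <- ns) \sum_(h <- hs) \sum_(m <- ns) \sum_(h' <- hs)
      if h == h' then kap n m else 0.
  rewrite natr_sum big_distrl; apply: eq_bigr => n _; rewrite big_distrlr /=.
  rewrite exchange_big; apply: eq_bigr => h _; apply: eq_bigr => m _.
  rewrite -big_mkcond -sum1_count natr_sum big_distrr /=.
  by apply: eq_big => [h'|h' _]; rewrite ?mulr1 // eq_sym.
rewrite -sumEFin big_seq [leRHS]big_seq; apply: lee_sum => n nn.
rewrite -sumEFin big_seq [leRHS]big_seq; apply: lee_sum => h hh.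
rewrite -sumEFin big_seq [leRHS]big_seq; apply: lee_sum => m mm.
rewrite -sumEFin; apply: lee_sum => h' _; rewrite /f /=; case: eqP => _.
  exact: kapP.
by rewrite integral0.
Qed.

Lemma integral_cos_le1 (R : realType) (mu : probability R R) (v : R) :
  (\int[mu]_x (cos (v * x))%:E <= 1)%E.
Proof.
rewrite -(probability_setT mu) -[leRHS]mul1e -(integral_cst mu measurableT 1%:E).
apply: le_integral => //.
- under eq_fun do rewrite -[X in cos X]add0r.
  apply: (@integrable_cos_affine _ _ R mu setT id) => //.
  by rewrite (le_lt_trans (probability_le1 _ _)) ?ltry.
- exact: finite_measure_integrable_cst.
- by move=> x _; rewrite lee_fin cos_le1.
Qed.

Lemma fourier_decay_cos (R : realType) (mu : probability R R) (tau : R) :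
  0 < tau -> fourier_decay mu tau ->
  exists2 C : R, 0 <= C & forall xi : R, 1 <= `|xi| ->
    (\int[mu]_x (cos (2 * pi * xi * x))%:E <= (C * `|xi| `^ (- tau))%:E)%E.
Proof.
move=> tau0 [C [M decay]].
(* The second entry serves 1 <= |xi| <= M, where the decay says nothing: there |M|^tau |xi|^(-tau)
   >= 1, which bounds any integral of a cosine. *)
exists (Num.max `|C| (`|M| `^ tau)); first by rewrite le_max normr_ge0.
move=> xi xi1; have xi0 : 0 < `|xi| by exact: lt_le_trans ltr01 xi1.
case: (ltP M `|xi|) => [Mxi|xiM]; last first.
  apply: le_trans (integral_cos_le1 _ _) _; rewrite lee_fin powRN.
  rewrite ler_pdivlMr ?powR_gt0 // mul1r le_max; apply/orP; right.
  apply: ge0_ler_powR; rewrite ?nnegrE ?(ltW tau0) //.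
  exact: le_trans xiM (ler_norm _).
have fi : mu.-integrable setT (fun x => (cos (2 * pi * xi * x))%:E).
  under eq_fun do rewrite -[X in cos X]add0r.
  apply: (@integrable_cos_affine _ _ R mu setT id) => //.
  by rewrite (le_lt_trans (probability_le1 _ _)) ?ltry.
have := le_trans (normc_ge_Re _) (decay xi Mxi); rewrite lecR /=.
rewrite -[X in (X <= _)%E]fineK ?integrable_fin_num // lee_fin => h.
apply: (le_trans (ler_norm _)).
have -> : fine (\int[mu]_x (cos (2 * pi * xi * x))%:E)%E =
    Rintegral mu setT (fun x => cos (2 * pi * x * xi)).
  by rewrite /Rintegral; under eq_integral do rewrite mulrAC.
apply: le_trans h _; apply: ler_wpM2r; first exact: powR_ge0.
by rewrite le_max ler_norm.
Qed.

Lemma normr_intr_ge1 (R : realType) (z : int) : z != 0 -> 1 <= `|z%:~R : R|.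
Proof. by move=> z0; rewrite -intr_norm ler1z -gtz0_ge1 normr_gt0. Qed.

(** Since |h| >= 1 and |m - n| >= 1, the separation gives |h (a_m - a_n)| >= c |m - n|^(1/tau), and
    the power -tau turns this into c^(-tau) / |m - n|. *)
Lemma integral_cos_separated (R : realType) (mu : probability R R) (tau : R)
    (a : nat -> int) (c eps : R) :
  0 < tau -> fourier_decay mu tau -> 0 < c -> 0 < eps ->
  (forall m n : nat, (0 < m)%N -> (0 < n)%N -> m <> n ->
    c * (`|(m%:R - n%:R : R)| `^ (tau^-1 + eps)) < `|((a m - a n)%:~R : R)|) ->
  exists2 C : R, 0 <= C & forall (m n : nat) (h : int),
    (0 < m)%N -> (0 < n)%N -> m <> n -> h != 0 ->
    (\int[mu]_x (cos (2 * pi * (h * (a m - a n))%:~R * x))%:E <=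
     (C / `|m%:R - n%:R|)%:E)%E.
Proof.
move=> tau0 decay c0 eps0 sep.
have [C C0 decayC] := fourier_decay_cos tau0 decay.
exists (C * c `^ (- tau)); first by rewrite mulr_ge0 ?powR_ge0.
move=> m n h m0 n0 mn h0; have smn := sep m n m0 n0 mn.
set D := `|m%:R - n%:R : R| in smn *.
have D1 : 1 <= D.
  have -> : D = `|(m%:Z - n%:Z)%:~R| by rewrite /D rmorphB.
  by apply: normr_intr_ge1; rewrite subr_eq0 eqz_nat; apply/eqP.
have D0 : 0 < D by exact: lt_le_trans ltr01 D1.
have cD : 0 < c * D `^ tau^-1 by rewrite mulr_gt0 ?powR_gt0.
have amn : c * D `^ tau^-1 <= `|(a m - a n)%:~R : R|.
  apply: le_trans (ltW smn); rewrite ler_pM2l // ler_powR // lerDl; exact: ltW.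
have h1 := normr_intr_ge1 R h0.
have xiE : c * D `^ tau^-1 <= `|(h * (a m - a n))%:~R : R|.
  rewrite intrM normrM; apply: le_trans amn _.
  by rewrite ler_peMl.
have xi1 : 1 <= `|(h * (a m - a n))%:~R : R|.
  apply: normr_intr_ge1; rewrite -(intr_eq0 R) -normr_gt0.
  exact: lt_le_trans cD xiE.
apply: le_trans (decayC _ xi1) _; rewrite lee_fin -mulrA.
apply: ler_wpM2l => //.
have -> : c `^ (- tau) / D = (c * D `^ tau^-1) `^ (- tau).
  rewrite powRM ?powR_ge0 ?(ltW c0) // -powRrM mulrN mulVf ?gt_eqF //.
  by rewrite powR_inv1 // ltW.
rewrite !powRN lef_pV2 ?posrE ?powR_gt0 ?(lt_le_trans ltr01 xi1) //.
by apply: ge0_ler_powR; rewrite ?nnegrE ?(ltW tau0) ?(ltW cD).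
Qed.

(** Each dyadic range contributes at most 1. *)
Lemma harmonic_le (R : realType) (j : nat) :
  \sum_(1 <= d < 2 ^ j) (d%:R : R)^-1 <= j%:R.
Proof.
elim: j => [|j IH]; first by rewrite big_geq.
have p0 : (0 < 2 ^ j)%N by rewrite expn_gt0.
rewrite (@big_cat_nat _ _ _ (2 ^ j)) //=; last by rewrite leq_exp2l.
rewrite -natr1; apply: lerD => //.
apply: (@le_trans _ _ (\sum_(2 ^ j <= d < 2 ^ j.+1) ((2 ^ j)%:R : R)^-1)).
  rewrite big_nat [leRHS]big_nat; apply: ler_sum => d /andP[jd _].
  by rewrite lef_pV2 ?posrE ?ltr0n ?ler_nat // (leq_trans p0).
rewrite sumr_const_nat expnS mul2n -addnn addnK -[leLHS]mulr_natl mulfV //.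
Qed.

(** Grouping by the distance d, at most the two indices n - d and n + d occur. *)
Lemma sum_inv_dist_le (R : realType) (s N n : nat) : n \in iota s N ->
  \sum_(m <- iota s N | m != n) `|n%:R - m%:R : R|^-1 <=
  2 * \sum_(1 <= d < N) (d%:R : R)^-1.
Proof.
move=> nN; pose dist m := ((n - m) + (m - n))%N.
have distE m : `|n%:R - m%:R : R| = (dist m)%:R.
  rewrite /dist; case: (leqP n m) => nm.
    by rewrite (eqP nm) add0n natrB // distrC ger0_norm // subr_ge0 ler_nat.
  rewrite (_ : m - n = 0)%N ?addn0; last by lia.
  by rewrite natrB ?(ltnW nm) // ger0_norm // subr_ge0 ler_nat ltnW.
rewrite [leLHS](_ : _ = \sum_(m <- iota s N) \sum_(1 <= d < N)
    if dist m == d then (d%:R : R)^-1 else 0); last first.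
  rewrite big_mkcond big_seq [RHS]big_seq; apply: eq_bigr => m.
  move: nN; rewrite !mem_iota => nN mN; rewrite -big_mkcond distE.
  case: eqVneq => [->|mn] /=.
    rewrite big_nat_cond big_pred0 // => d; rewrite /dist; lia.
  rewrite (big_rem (dist m)) /=; last by rewrite mem_index_iota /dist; lia.
  rewrite eqxx big_seq_cond big_pred0 ?addr0 // => d.
  rewrite mem_rem_uniq ?iota_uniq // inE /= eq_sym; case: eqP => // _.
  by rewrite andbF.
rewrite exchange_big mulr_sumr; apply: ler_sum => d _.
rewrite -big_mkcond big_const_seq iter_addr addr0 -[leLHS]mulr_natl.
apply: ler_wpM2r; first by rewrite invr_ge0.
rewrite ler_nat.
apply: (@leq_trans (count_mem (n + d)%N (iota s N) +
                    count_mem (n - d)%N (iota s N))).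
  rewrite -count_predUI; apply: leq_trans (leq_addr _ _).
  by apply: sub_count => m /=; rewrite /dist; lia.
by rewrite !count_uniq_mem ?iota_uniq //; case: (_ \in _); case: (_ \in _).
Qed.

(** On the bad set [B] every [U i] with i >= I is at least 1/(k + 1). Markov's inequality, applied
    to a single [i] with small integral, makes the measure of [B] smaller than any given bound. *)
Lemma ae_frequently_small d (T : measurableType d) (R : realType)
    (m : {measure set T -> \bar R}) (U : nat -> T -> R) :
  (forall i, measurable_fun setT (U i)) -> (forall i x, 0 <= U i x) ->
  (forall (I : nat) (e : R), 0 < e ->
    exists2 i, (I <= i)%N & (\int[m]_x (U i x)%:E <= e%:E)%E) ->
  {ae m, forall x, forall (I : nat) (e : R), 0 < e ->
    exists2 i, (I <= i)%N & U i x < e}.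
Proof.
move=> mU U0 small.
suff: {ae m, forall x, forall I k : nat,
    exists2 i, (I <= i)%N & U i x < k.+1%:R^-1}.
  apply: filterS => x Ux I e e0.
  have [i Ii Ui] := Ux I (Num.truncn e^-1); exists i => //.
  apply: lt_trans Ui _; rewrite invf_plt ?posrE ?ltr0n //.
  exact: truncnS_gt.
apply: ae_foralln => I; apply: ae_foralln => k.
pose B := \bigcap_(i in [set i | (I <= i)%N]) [set x | k.+1%:R^-1 <= U i x].
have mB : measurable B.
  apply: bigcap_measurable; first by exists I => /=.
  move=> i _; rewrite -[X in measurable X]setTI.
  exact: measurable_fun_le.
exists B; split => //; last first.
  move=> x /= nx i Ii /=; rewrite leNgt; apply/negP => Ui; apply: nx.
  by exists i.
apply/eqP; rewrite eq_le measure_ge0 andbT; apply/lee_addgt0Pr => e e0.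
have e'0 : 0 < e / k.+1%:R by rewrite divr_gt0.
have [i Ii Ui] := small I _ e'0; rewrite add0e.
have := @integral_ge_measure _ _ _ m setT B (U i) k.+1%:R^-1 measurableT mB
  (@subsetT _ _) (mU i).
rewrite invr_ge0 ler0n => /(_ isT (fun x _ => U0 i x)) /(_ (fun x Bx => Bx i Ii)).
by move=> /le_trans /(_ Ui); rewrite mulrC EFinM lee_pmul2l // lte_fin invr_gt0.
Qed.

(** * The mean-free kernel on dyadic blocks *)

Definition nonzero_freqs (K p : nat) : seq int :=
  [seq h <- diff_freqs K p | h != 0].

Definition mass0 (K p : nat) : nat := count_mem 0%R (diff_freqs K p).

Lemma sum_cos_nonzero_freqs (R : realType) (K p : nat) (x : R) :
  \sum_(h <- nonzero_freqs K p) cos (2 * pi * (h%:~R * x)) =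
  \sum_(h <- diff_freqs K p) cos (2 * pi * (h%:~R * x)) - (mass0 K p)%:R.
Proof.
apply/eqP; rewrite eq_sym subr_eq big_filter /mass0 -sum1_count natr_sum.
rewrite (bigID (fun h => h != 0)) /=; apply/eqP; congr (_ + _).
under [RHS]eq_bigl => h do rewrite -[_ == _]negbK.
by apply: eq_bigr => h /negPn /eqP ->; rewrite mul0r mulr0 cos0.
Qed.

Lemma sum_count_nonzero_freqs (K p : nat) :
  (\sum_(h <- nonzero_freqs K p.+1) count_mem h (nonzero_freqs K p.+1) <=
   K ^ p.+1 * K ^ p.+1 * (K ^ p.+1 * K ^ p))%N.
Proof.
rewrite -(size_diff_freqs K p.+1) -sum1_size big_distrl big_filter big_mkcond /=.
apply: leq_sum => h _; rewrite mul1n; case: ifP => // _.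
apply: leq_trans (count_diff_freqs K p h); rewrite count_filter.
by apply: sub_count => g /= /andP[].
Qed.

Section parameters.
                                                                            
                                                       
                                                
Variables k i : nat.
Let q := k.+2.

(** The three exponents are balanced: K is smaller than B by the factor 2^i, which makes the
    averaged second moment small, and larger than the inverse radius by 2^(i - 1), which makes the
    mean of the kernel dominate its values far from the integers. *)
Definition block_size := (2 ^ (q * i))%N.
Definition kernel_size := (2 ^ (k.+1 * i))%N.
Definition inv_radius := (2 ^ (k * i).+1)%N.

(** With qK + 1 <= 2^q K, it remains to compare exponents: 2q(ki + 1) + q + 1 <= (2q - 1)(k + 1)i,
    true for i >= 3. *)
Lemma mass0_ge : (2 < i)%N ->
  (2 * inv_radius ^ (2 * q) <= mass0 kernel_size q)%N.
Proof.
move=> i2; have := count_diff_freqs0 kernel_size q.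
rewrite -/(mass0 _ _); set c := mass0 _ _.
have qK : ((q * kernel_size).+1 <= 2 ^ q * kernel_size)%N.
  apply: (@leq_trans (q.+1 * kernel_size)).
    by rewrite mulSn addnC -addn1 leq_add2l expn_gt0.
  by rewrite leq_mul2r ltn_expl ?orbT.
move=> h; rewrite -(@leq_pmul2l (q * kernel_size).+1) //.
apply: leq_trans _ h; apply: (leq_trans (leq_mul qK (leqnn _))).
rewrite /kernel_size /inv_radius -!expnM -!expnD -expnS -expnD leq_exp2l //.
rewrite /q; nia.
Qed.

Lemma mass0_mul_ge : (kernel_size ^ q * kernel_size ^ q <=
  q.+1 * kernel_size * mass0 kernel_size q)%N.
Proof.
apply: leq_trans (count_diff_freqs0 _ _) _; rewrite leq_mul2r.
by rewrite mulSn addnC -addn1 leq_add2l expn_gt0 orbT.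
Qed.

Variables (R : realType) (a : nat -> int).

Definition block := iota block_size.+1 block_size.

Definition block_corr : R -> R :=
  corr [seq a n | n <- block] (nonzero_freqs kernel_size q).

Definition block_threshold : R :=
  (block_size%:R * (mass0 kernel_size q)%:R / 2) ^+ 2.

Lemma block_threshold_gt0 : (2 < i)%N -> 0 < block_threshold.
Proof.
move=> i2; rewrite exprn_gt0 // divr_gt0 // mulr_gt0 ?ltr0n ?expn_gt0 //.
by rewrite (leq_trans _ (mass0_ge i2)) // muln_gt0 /inv_radius !expn_gt0.
Qed.

Lemma far_block_large (alpha g : R) : (2 < i)%N -> (0 < k)%N ->
  (forall n (z : int), n \in block ->
    inv_radius%:R^-1 <= `|(a n)%:~R * alpha - g - z%:~R|) ->
  block_threshold <= (\sum_(b <- [seq a n | n <- block])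
    \sum_(h <- nonzero_freqs kernel_size q)
      cos (2 * pi * (h%:~R * (b%:~R * alpha - g)))) ^+ 2.
Proof.
move=> i2 k0 far; rewrite big_map /block_threshold -[leRHS]sqrrN.
set c := mass0 _ _.
have r0 : 0 < (inv_radius%:R : R)^-1 <= 4^-1.
  rewrite invr_gt0 ltr0n expn_gt0 lef_pV2 ?posrE ?ltr0n ?expn_gt0 // ler_nat.
  by rewrite /inv_radius (@leq_pexp2l 2 2) // ltnS muln_gt0 k0; lia.
(* Each n contributes at most r^(-2q) - c <= -c/2. All terms being negative, the bound survives
   squaring, hence the sign change above. *)
have mono : block_size%:R * c%:R / 2 <= - (\sum_(n <- block)
    \sum_(h <- nonzero_freqs kernel_size q)
      cos (2 * pi * (h%:~R * ((a n)%:~R * alpha - g)))).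
  have -> : block_size%:R * c%:R / 2 = \sum_(n <- block) c%:R / 2 :> R.
    by rewrite big_const_seq count_predT size_iota iter_addr addr0 -[RHS]mulr_natl mulrA.
  rewrite -sumrN big_seq [leRHS]big_seq; apply: ler_sum => n nb.
  rewrite sum_cos_nonzero_freqs -/c.
  have := @sum_cos_diff_freqs_far R kernel_size q _ _ r0 (fun z => far n z nb).
  have : (2 * inv_radius ^ (2 * q))%:R <= c%:R :> R by rewrite ler_nat mass0_ge.
  rewrite natrM natrX exprM -[_ ^- 2]exprVn invrK.
  by lra.
by rewrite lerXn2r ?nnegrE ?(le_trans _ mono) // divr_ge0 ?mulr_ge0.
Qed.

(** For each n the diagonal term gives 1 and the others at most 2C times a harmonic sum, bounded by
    log_2 B = q i. The last factor bounds the sum of squared multiplicities. *)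
Lemma integral_block_corr (mu : probability R R) (C : R) : 0 <= C ->
  (forall (m n : nat) (h : int),
    (0 < m)%N -> (0 < n)%N -> m <> n -> h != 0 ->
    (\int[mu]_x (cos (2 * pi * (h * (a m - a n))%:~R * x))%:E <=
     (C / `|m%:R - n%:R|)%:E)%E) ->
  (\int[mu]_x (block_corr x)%:E <=
   (block_size%:R * (1 + 2 * C * (q * i)%:R) *
    (kernel_size ^ q * kernel_size ^ q *
      (kernel_size ^ q * kernel_size ^ q.-1))%:R)%:E)%E.
Proof.
move=> C0 decay.
pose kap (n m : nat) : R := if m == n then 1 else C / `|n%:R - m%:R|.
apply: le_trans (integral_corr_le (kap := kap) _) _.
  move=> n m h; rewrite !mem_iota mem_filter => nb mb /andP[h0 _].
  rewrite /kap; case: eqP => [->|mn]; last by apply: decay => //; lia.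
  exact: integral_cos_le1.
rewrite lee_fin; apply: ler_pM.
- by do 2 (apply: sumr_ge0 => ? _); rewrite /kap; case: ifP => // _; rewrite divr_ge0.
- by [].
- rewrite (_ : block_size%:R * _ = \sum_(n <- block) (1 + 2 * C * (q * i)%:R)); last first.
    by rewrite big_const_seq count_predT size_iota iter_addr addr0 -[RHS]mulr_natl.
  rewrite big_seq [leRHS]big_seq; apply: ler_sum => n nb.
  rewrite (bigID (fun m => m == n)) /=; apply: lerD.
    under eq_bigr => m mn do rewrite /kap mn.
    by rewrite big_const_seq iter_addr addr0 count_uniq_mem ?iota_uniq // nb.
  under eq_bigr => m mn do rewrite /kap (negPf mn).
  rewrite -mulr_sumr -[2 * C]mulrC -mulrA; apply: ler_wpM2l => //.
  apply: le_trans (sum_inv_dist_le R nb) _.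
  by rewrite ler_wpM2l // harmonic_le.
- by rewrite ler_nat sum_count_nonzero_freqs.
Qed.

End parameters.

(** * Second moment against threshold *)

Lemma mass0_ratio (k i : nat) :
  (kernel_size k i ^ k.+2 * kernel_size k i ^ k.+2 *
    (kernel_size k i ^ k.+2 * kernel_size k i ^ k.+1) * 2 ^ i <=
   k.+3 ^ 2 * block_size k i * mass0 (kernel_size k i) k.+2 ^ 2)%N.
Proof.
have h := mass0_mul_ge k i; set K := kernel_size k i in h *.
set c := mass0 _ _ in h *.
have BK : block_size k i = (K * 2 ^ i)%N.
  by rewrite /block_size /K /kernel_size -expnD; congr (_ ^ _)%N; lia.
have K0 : (0 < K)%N by rewrite expn_gt0.
(* The extra factor K turns the claim into the square of [mass0_mul_ge], multiplied by 2^i = B /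
   K. *)
rewrite BK -(leq_pmul2l K0).
have := leq_mul h h; rewrite expnS.
set P := (K ^ k.+1)%N; have : (0 < 2 ^ i)%N by rewrite expn_gt0.
move: (2 ^ i)%N => T T0 h2.
have -> : (K * (K * P * (K * P) * (K * P * P) * T) =
  (K * P * (K * P) * (K * P * (K * P))) * T)%N by ring.
have -> : (K * (k.+3 ^ 2 * (K * T) * c ^ 2) =
  (k.+3 * K * c * (k.+3 * K * c)) * T)%N by ring.
by rewrite leq_mul2r h2 orbT.
Qed.

Lemma sq_le_exp2 (i : nat) : (3 < i)%N -> (i ^ 2 <= 2 ^ i)%N.
Proof.
case: i => [|[|[|[|i]]]] // _; elim: i => [//|i IH].
rewrite expnS; apply: leq_trans (leq_mul (leqnn 2) IH); nia.
Qed.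

(** Used with P = K^(4q - 1), c = [mass0], T = 2^i, s = q + 1, X = 1 + 2Cq and Y = 1 + 2Cqi.
    Replacing 2^i by i^2 still leaves a bound of order 1/i. *)
Lemma ratio_arith (R : realType) (P B c T i s X Y : R) :
  0 <= P -> 0 <= B -> 0 < i -> 0 <= X ->
  P * T <= s ^+ 2 * B * c ^+ 2 -> i ^+ 2 <= T -> Y <= X * i ->
  B * Y * P <= (B * c / 2) ^+ 2 * (4 * s ^+ 2 * X / i).
Proof.
move=> P0 B0 i0 X0 PT iT YX.
have Pi : P * i ^+ 2 <= s ^+ 2 * B * c ^+ 2.
  by apply: le_trans PT; rewrite ler_wpM2l.
rewrite mulrA ler_pdivlMr //.
have -> : (B * c / 2) ^+ 2 * (4 * s ^+ 2 * X) = B * (X * (s ^+ 2 * B * c ^+ 2)).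
  by field.
have -> : B * Y * P * i = B * (Y * (P * i)) by ring.
rewrite ler_wpM2l //.
apply: (@le_trans _ _ (X * i * (P * i))); first by rewrite ler_wpM2r // mulr_ge0 // ltW.
have -> : X * i * (P * i) = X * (P * i ^+ 2) by ring.
by rewrite ler_wpM2l.
Qed.

Section blocks.
Variables (R : realType) (a : nat -> int) (k : nat).

(** Bounds the measure of the gamma missed by block j + 3; the shift secures i > 2, as [mass0_ge]
    requires. *)
Definition block_ratio (j : nat) (x : R) : R :=
  block_corr k (j + 3) a x / block_threshold k (j + 3) R.

Lemma block_ratio_ge0 (j : nat) (x : R) : 0 <= block_ratio j x.
Proof. by rewrite divr_ge0 ?corr_ge0 ?sqr_ge0. Qed.

Lemma measurable_block_ratio (j : nat) : measurable_fun setT (block_ratio j).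
Proof.
apply: measurable_funM; last exact: measurable_cst.
exact: measurable_corr.
Qed.

Lemma integral_block_ratio_small (mu : probability R R) (C : R) : 0 <= C ->
  (forall (m n : nat) (h : int),
    (0 < m)%N -> (0 < n)%N -> m <> n -> h != 0 ->
    (\int[mu]_x (cos (2 * pi * (h * (a m - a n))%:~R * x))%:E <=
     (C / `|m%:R - n%:R|)%:E)%E) ->
  forall (I : nat) (e : R), 0 < e ->
    exists2 j, (I <= j)%N & (\int[mu]_x (block_ratio j x)%:E <= e%:E)%E.
Proof.
move=> C0 decay I e e0.
pose D : R := 4 * (k.+3%:R) ^+ 2 * (1 + 2 * C * k.+2%:R).
have X0 : 0 <= 1 + 2 * C * k.+2%:R by rewrite addr_ge0 // mulr_ge0 // mulr_ge0.
have [t tD] : exists t, D / e < t.+1%:R by exists (Num.truncn (D / e)); exact: truncnS_gt.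
pose j := (I + t.+1)%N; exists j; first exact: leq_addr.
pose i := (j + 3)%N; have i3 : (3 < i)%N by rewrite /i /j; lia.
have t0 := @block_threshold_gt0 k i R (ltnW i3).
have De : D / i%:R <= e.
  rewrite ler_pdivrMr ?ltr0n ?(leq_trans _ i3) // mulrC -ler_pdivrMr //.
  apply: ltW; apply: lt_le_trans tD _; rewrite ler_nat /i /j; lia.
have mc := @measurable_corr R [seq a n | n <- block k i]
  (nonzero_freqs (kernel_size k i) k.+2).
rewrite (_ : (\int[mu]_x (block_ratio j x)%:E =
    (block_threshold k i R)^-1%:E * \int[mu]_x (block_corr k i a x)%:E)%E); last first.
  rewrite -ge0_integralZl_EFin ?invr_ge0 ?(ltW t0) //.
  - by apply: eq_integral => x _; rewrite -EFinM mulrC.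
  - by move=> x _; rewrite lee_fin corr_ge0.
  - exact/measurable_EFinP.
rewrite lee_pdivrMl //; apply: le_trans (integral_block_corr _ _ C0 decay) _.
rewrite -EFinM lee_fin /=.
apply: (@le_trans _ _ (block_threshold k i R * (D / i%:R))); last first.
  by rewrite ler_wpM2l // ltW.
have i1 : 1 <= i%:R :> R by rewrite ler1n; lia.
apply: (@ratio_arith _ _ _ _ (2 ^ i)%:R) => //.
- by rewrite ltr0n; lia.
- by rewrite -!natrX -!natrM ler_nat mass0_ratio.
- by rewrite -natrX ler_nat sq_le_exp2.
- by rewrite natrM; lra.
Qed.

(** As n <= 2^(qi + 1) and sigma <= k/q, the power n^sigma is at most 2^(ki + k/q), and k/q <= 1. *)
Lemma inv_radius_le (sigma : R) (i n : nat) :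
  sigma * k.+2%:R <= k%:R -> n \in block k i ->
  (inv_radius k i)%:R^-1 <= n%:R `^ (- sigma).
Proof.
move=> sk; rewrite mem_iota => /andP[n0 nB].
have q0 : 0 < k.+2%:R :> R by rewrite ltr0n.
have n1 : 1 <= n%:R :> R by rewrite ler1n (leq_trans _ n0).
have nB2 : n%:R <= 2 `^ (k.+2 * i).+1%:R :> R.
  rewrite powR_mulrn // -natrX ler_nat expnS mul2n -addnn.
  by move: nB; rewrite /block_size; lia.
apply: (@le_trans _ _ (n%:R `^ (- (k%:R / k.+2%:R)))); last first.
  by rewrite ler_powR // lerN2 ler_pdivlMr.
rewrite powRN lef_pV2 ?posrE ?powR_gt0 ?ltr0n ?expn_gt0 //; last by rewrite (leq_trans _ n0).
apply: (@le_trans _ _ ((2 `^ (k.+2 * i).+1%:R) `^ (k%:R / k.+2%:R))).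
  by apply: ge0_ler_powR; rewrite ?nnegrE ?divr_ge0 ?powR_ge0.
rewrite -powRrM /inv_radius natrX -powR_mulrn // ler_powR ?ler1n //.
rewrite mulrA ler_pdivrMr // -!natrM ler_nat; nia.
Qed.

End blocks.

(** * The limsup set and its complement *)

Lemma infinite_nat_setP (A : set nat) :
  infinite_set A <-> forall I : nat, exists2 n, (I <= n)%N & A n.
Proof.
split=> [infA I|unbA /finite_seqP[s As]].
  apply: contrapT => nA; apply: infA; apply: (sub_finite_set _ (finite_II I)).
  move=> n An /=; rewrite ltnNge; apply/negP => In; apply: nA; by exists n.
have [n sn] := unbA (\max_(m <- s) m).+1; rewrite As /= => ns.
by move: sn; rewrite ltnNge (leq_bigmax_seq n ns).
Qed.

Lemma dist_nearest_int_lt (R : realType) (x r : R) :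
  dist_nearest_int x < r <-> exists z : int, `|x - z%:~R| < r.
Proof.
split=> [/inf_lt|[z xz]].
  by case=> [|_ [z _ <-] zr]; [exists `|x - 0%:~R|; exists 0 | exists z].
apply: le_lt_trans xz; apply: ge_inf; last by exists z.
by exists 0 => _ [y _ <-].
Qed.

Lemma measurable_dist_lt (R : realType) (y r : R) :
  measurable [set g : R | dist_nearest_int (y - g) < r].
Proof.
have -> : [set g : R | dist_nearest_int (y - g) < r] =
    \bigcup_(z in [set: int]) `]y - z%:~R - r, y - z%:~R + r[%classic.
  apply/seteqP; split=> g /=.
    move/dist_nearest_int_lt => [z]; rewrite ltr_norml => zr.
    by exists z => //=; rewrite in_itv /=; lra.
  case=> z _ /=; rewrite in_itv /= => zr; apply/dist_nearest_int_lt; exists z.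
  by rewrite ltr_norml; lra.
apply: open_measurable; apply: bigcup_open => z _; exact: interval_open.
Qed.

Section limsup.
Variables (R : realType) (psi : nat -> R) (a : nat -> int) (alpha : R).

(** The shift to [n.+1] matches [W], where index 0 does not count. *)
Definition missed (I : nat) : set R := `[0, 1] `&`
  \bigcap_(n in [set n | (I <= n)%N])
    ~` [set g | dist_nearest_int ((a n.+1)%:~R * alpha - g) < psi n.+1].

Lemma measurable_missed (I : nat) : measurable (missed I).
Proof.
apply: measurableI => //; apply: bigcap_measurable; first by exists I => /=.
by move=> n _; apply: measurableC; exact: measurable_dist_lt.
Qed.

Lemma W_missed : W psi a alpha = `[0, 1] `\` \bigcup_I missed I.
Proof.
apply/seteqP; split=> g /=.
  case=> g01 /infinite_nat_setP inf; split=> // -[I _ [_ mis]].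
  have [[//|n] In [_ hit]] := inf I.+1; exact: (mis n In hit).
case=> g01 nmis; split=> //; apply/infinite_nat_setP => I.
apply: contrapT => nhit; apply: nmis; exists I => //; split=> // n /= In hit.
by apply: nhit; exists n.+1 => //; exact: leqW.
Qed.

Lemma measure_W_eq1 : (forall I, lebesgue_measure (missed I) = 0%E) ->
  lebesgue_measure (W psi a alpha) = 1%E.
Proof.
move=> mis0.
have mB : measurable (\bigcup_I missed I).
  by apply: bigcupT_measurable => I; exact: measurable_missed.
have B0 : lebesgue_measure (\bigcup_I missed I) = 0%E.
  apply: measure_negligible => //; apply: negligible_bigcup => I.
  by apply/negligibleP; [exact: measurable_missed | exact: mis0].
have BE : \bigcup_I missed I `<=` `[0, 1] by move=> g [I _ []].
have mW : measurable (W psi a alpha) by rewrite W_missed; exact: measurableD.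
have <- := @measureU0 _ (measurableTypeR R) R lebesgue_measure _ _ mW mB B0.
have l01 : @lebesgue_measure R `[0%R, 1%R]%classic = 1%E.
  by rewrite lebesgue_measure_itv /= lte_fin ltr01 oppr0 adde0.
by rewrite W_missed setUC setDUK.
Qed.

End limsup.

Unset Implicit Arguments.

(** * Conclusion *)

Theorem theorem1p1 (R : realType) (mu : probability R R) (tau : R)
    (a : nat -> int) (c eps sigma : R)
    (mu01 : mu [set x : R | x \in `[0, 1]] = 1%E)
    (mu_dim : 0 < fourier_dimension mu)
    (tau_gt0 : 0 < tau)
    (mu_decay : fourier_decay mu tau)
    (c_gt0 : 0 < c)
    (eps_gt0 : 0 < eps)
    (a_sep : forall m n : nat, (0 < m)%N -> (0 < n)%N -> m <> n ->
       c * (`|(m%:R - n%:R : R)| `^ (tau^-1 + eps)) < `|((a m - a n)%:~R : R)|)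
    (sigma_lt1 : sigma < 1) :
  {ae mu, forall alpha : R,
    lebesgue_measure (W (fun n : nat => n%:R `^ (- sigma)) a alpha) = 1%E}.
Proof.
have [C C0 decay] := integral_cos_separated tau_gt0 mu_decay c_gt0 eps_gt0 a_sep.
have [k k0 sk] : exists2 k : nat, (0 < k)%N & sigma * k.+2%:R <= k%:R.
  (* The condition sigma (k + 2) <= k amounts to k >= 2 sigma / (1 - sigma); the successor also
     gives k > 0. *)
  exists (Num.truncn (2 * sigma / (1 - sigma))).+1 => //.
  set t := Num.truncn _.
  have : 2 * sigma / (1 - sigma) < t.+1%:R by exact: truncnS_gt.
  rewrite ltr_pdivrMr ?subr_gt0 // => h; rewrite -natr1 -natr1; lra.
have small := integral_block_ratio_small k C0 decay.
have := ae_frequently_small (measurable_block_ratio a k) (block_ratio_ge0 a k) small.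
apply: filterS => alpha good; apply: measure_W_eq1 => I.
apply/eqP; rewrite eq_le measure_ge0 andbT; apply/lee_addgt0Pr => e e0.
have [j Ij] := good I e e0; set i := (j + 3)%N; rewrite add0e.
have i2 : (2 < i)%N by rewrite /i; lia.
have t0 := @block_threshold_gt0 k i R i2.
rewrite /block_ratio -/i ltr_pdivrMr // => Ue.
have := @measure_large_expsum R [seq a n | n <- block k i]
  (nonzero_freqs (kernel_size k i) k.+2) alpha (block_threshold k i R) _
  (measurable_missed (fun n => n%:R `^ (- sigma)) a alpha I)
  (@subIsetl _ _ _) (ltW t0).
have far g : missed (fun n => n%:R `^ (- sigma)) a alpha I g ->
    forall n (z : int), n \in block k i ->
    (inv_radius k i)%:R^-1 <= `|(a n)%:~R * alpha - g - z%:~R|.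
  move=> [_ mis] n z nb; apply: le_trans (inv_radius_le sk nb) _.
  rewrite leNgt; apply/negP => nz; move: nb; rewrite mem_iota.
  case: n nz => [//|n] nz /andP[nb _].
  apply: (mis n); last by apply/dist_nearest_int_lt; exists z.
  rewrite /=; apply: leq_trans Ij _; apply: leq_trans (_ : i <= n)%N.
    by rewrite /i leq_addr.
  (* The block lies beyond [I], since its indices exceed 2^(q i) > i >= j >= I. *)
  rewrite -ltnS; apply: leq_trans nb; rewrite ltnS; apply: ltnW.
  apply: leq_trans (ltn_expl i (isT : 1 < 2)%N) _.
  by rewrite leq_exp2l // leq_pmull.
move=> /(_ (fun g mg => far_block_large i2 k0 (far g mg))).
rewrite -/(block_corr k i a alpha) => /le_trans le_corr.
have := le_corr (e * block_threshold k i R)%:E.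
rewrite lee_fin (ltW Ue) => /(_ isT).
by rewrite [e * _]mulrC (EFinM _ e) lee_pmul2l // lte_fin.
Qed.
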